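(* Let $0<q<1$ and let $b$ be a nonzero complex parameter for which all denominators below are nonzero. Define, for $n\ge 0$, $$A_n(q,q,b)=\frac{(-1)^n(1-q^{2n+1})\,q^{n(3n-1)/2}\,b^n\,(q/b;q)_n}{(1-q)\,(bq;q)_n}\left(1+\sum_{1\le j\le n}\frac{(q;q)_{j-1}(1-q^{2j})(b;q)_j\,q^{-j^2}b^{-j}}{(q;q)_j\,(q/b;q)_j}\right).$$ Then (i) the pair $$\alpha_n=q^{-n(n+1)/2}A_n(q,q,b),\qquad \beta_n=\frac{1}{(-q;q)_n(bq;q)_n}\sum_{0\le k\le n}\frac{(b;q)_k}{(q;q)_k}(-1)^k$$ is a Bailey pair relative to $(q,q)$; and (ii) the pair $$\alpha_n=\frac{1+q^{1/2}}{1+q^{n+1/2}}\,q^{-n^2/2}A_n(q,q,b),\qquad \beta_n=\frac{1}{(-q^{3/2};q)_n(bq;q)_n}\sum_{0\le k\le n}\frac{(b;q)_k}{(q;q)_k}(-q^{1/2})^k$$ is also a Bailey pair relative to $(q,q)$.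
   Context: For complex $w$: $(w;q)_0=1$, $(w;q)_n=\prod_{i=0}^{n-1}(1-wq^i)$, $(w;q)_\infty=\prod_{i\ge0}(1-wq^i)$. A pair of sequences $(\alpha_n,\beta_n)_{n\ge0}$ is a Bailey pair relative to $(a,q)$ if for all $n\ge 0$, $\beta_n=\sum_{0\le j\le n}\frac{\alpha_j}{(q;q)_{n-j}(aq;q)_{n+j}}$; here $a=q$, so $(aq;q)_{n+j}=(q^2;q)_{n+j}$.
   Formalization: The exponent n(3n-1)/2 of q in A_n(q,q,b) is corrected to n(3n+1)/2; with the printed exponent the Bailey relation in (i) already fails at n=1 (for example q=1/2, b=1), where α_1 is off by a factor 1/q. *)

(* Defs.v *)
From HB Require Import structures.
From mathcomp Require Import all_boot all_order all_algebra.
From mathcomp Require Export reals complex.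

Set Implicit Arguments.
Unset Strict Implicit.
Unset Printing Implicit Defensive.

Import Order.TTheory GRing.Theory Num.Theory.

Local Open Scope ring_scope.

Definition qpoch (F : fieldType) (w q : F) (n : nat) : F :=
  \prod_(i < n) (1 - w * q ^+ i).

Definition bailey_pair (F : fieldType) (a q : F) (alpha beta : nat -> F) : Prop :=
  forall n : nat,
    beta n = \sum_(j < n.+1)
               alpha j / (qpoch q q (n - j) * qpoch (a * q) q (n + j)).

(* A_n(a,q,b) at a = q, for which A_n and B_n = 1/(bq;q)_n form a Bailey pair
   relative to (q,q). It is the limit c -> 0 of the Andrews-Hickerson pair with
   parameters b, c; that limit carries a factor a^n q^(n(3n-1)/2), so at a = q
   the power of q is n(3n+1)/2. The printed exponent n(3n-1)/2 omits a^n, and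
   with it the Bailey relation already fails at n = 1. *)
Definition Aqq (F : fieldType) (q b : F) (n : nat) : F :=
  ((-1) ^+ n * (1 - q ^+ (2 * n + 1)) * q ^+ (n * (3 * n + 1))./2 * b ^+ n
     * qpoch (q / b) q n)
  / ((1 - q) * qpoch (b * q) q n)
  * (1 + \sum_(1 <= j < n.+1)
           (qpoch q q j.-1 * (1 - q ^+ (2 * j)) * qpoch b q j
              * q ^- (j ^ 2) * b ^- j)
           / (qpoch q q j * qpoch (q / b) q j)).

(* Main.v *)
(** Inverting the Bailey relation for [beta_n = 1/(bq;q)_n] gives a sum which,
    by a telescoping certificate, obeys the first order recurrence in [n] that
    defines [A_n(q,q,b)]; so [A_n] and [1/(bq;q)_n] form a Bailey pair. Bailey's
    lemma with parameters [rho1 -> 0] and [rho2 = rho] then multiplies [A_n] by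
    [(rho;q)_n (-1)^n / (rho^n q^(n(n-1)/2) (q^2/rho;q)_n)], and the transformed
    [beta_n] collapses to a partial sum of [sum_k (b;q)_k/(q;q)_k (q/rho)^k].
    Part (i) is [rho = -q] and part (ii) is [rho = -q^(1/2)]. *)
Require Import Defs.
From mathcomp Require Import all_boot all_order all_algebra.
From mathcomp Require Import reals complex.
From mathcomp Require Import ring zify.

Import Order.TTheory GRing.Theory Num.Theory.

Local Open Scope ring_scope.
Local Open Scope complex_scope.

(** * Rearranging and telescoping finite sums *)

(** The inner index is shifted to start at 0, the form in which the terminating sums below apply to
    the coefficient of a fixed [m]. *)
Lemma sum_triangle_exchange (V : nmodType) (f : nat -> nat -> V) n :
  \sum_(j < n.+1) \sum_(m < j.+1) f j m =
  \sum_(m < n.+1) \sum_(i < (n - m).+1) f (m + i)%N m.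
Proof.
elim: n => [|n IH]; first by rewrite !big_ord1.
rewrite big_ord_recr /= IH [RHS]big_ord_recr /= subnn big_ord1 addn0.
rewrite [X in _ + X = _]big_ord_recr /= addrA; congr (_ + _).
rewrite -big_split /=; apply: eq_bigr => m _.
have lemn : (m <= n)%N by rewrite -ltnS.
by rewrite subSn // [RHS]big_ord_recr /= addnS subnKC.
Qed.

(* Zeilberger's method: [g] is the certificate of the recurrence satisfied by
   the sums of [s] (at [n]) and [s'] (at [n.+1]). *)
Lemma sum_telescope_rec (R : pzRingType) (s' s g : nat -> R) (c : R) n :
    (forall j, (j <= n)%N -> s' j - c * s j = g j.+1 - g j) ->
    s' n.+1 + g n.+1 = 0 ->
  \sum_(j < n.+2) s' j = c * (\sum_(j < n.+1) s j) - g 0%N.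
Proof.
move=> step top; rewrite big_ord_recr /= -(subrK (c * \sum_(j < n.+1) s j)
  (\sum_(j < n.+1) s' j)) mulr_sumr -sumrB.
have -> : \sum_(j < n.+1) (s' j - c * s j) = g n.+1 - g 0%N.
  rewrite -(big_mkord xpredT (fun j => s' j - c * s j)).
  rewrite -(telescope_sumr g (leq0n n.+1)) !big_nat.
  by apply: eq_bigr => j /andP[_ ltj]; apply: step.
by rewrite -(addrK (g n.+1) (s' n.+1)) top sub0r addrC addrA addrA addNr add0r addrC.
Qed.

(** * q-Pochhammer symbols: splitting and nonvanishing *)

Section QPochhammer.
Variable F : fieldType.
Implicit Types (w q : F) (m n : nat).

Lemma qpoch0 w q : qpoch w q 0 = 1.
Proof. by rewrite /qpoch big_ord0. Qed.

Lemma qpochS w q n : qpoch w q n.+1 = qpoch w q n * (1 - w * q ^+ n).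
Proof. by rewrite /qpoch big_ord_recr. Qed.

Lemma qpochD w q m n :
  qpoch w q (m + n) = qpoch w q m * qpoch (w * q ^+ m) q n.
Proof.
elim: n => [|n IH]; first by rewrite addn0 qpoch0 mulr1.
by rewrite addnS !qpochS IH exprD !mulrA.
Qed.

Lemma qpochSl w q n : qpoch w q n.+1 = (1 - w) * qpoch (w * q) q n.
Proof. by rewrite -add1n qpochD qpochS qpoch0 mul1r expr0 mulr1 expr1. Qed.

Lemma qpoch_factor_neq0 w q n :
  (forall m, qpoch w q m != 0) -> 1 - w * q ^+ n != 0.
Proof. by move=> h; move: (h n.+1); rewrite qpochS mulf_eq0 negb_or => /andP[]. Qed.

Lemma qpoch_neq0 w q :
  (forall m, 1 - w * q ^+ m != 0) -> forall n, qpoch w q n != 0.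
Proof. by move=> h n; apply/prodf_neq0 => i _. Qed.

Lemma qpoch_shift_neq0 w q k :
  (forall m, qpoch w q m != 0) -> forall n, qpoch (w * q ^+ k) q n != 0.
Proof.
by move=> h n; move: (h (k + n)%N); rewrite qpochD mulf_eq0 negb_or => /andP[].
Qed.

End QPochhammer.

(** * Terminating q-hypergeometric sums *)

Section BaileyPairs.
Variables (F : fieldType) (q : F).
Hypotheses (q_neq0 : q != 0) (qq_neq0 : forall n, qpoch q q n != 0).

Let onesubq n : 1 - q * q ^+ n != 0.
Proof. exact: qpoch_factor_neq0. Qed.

Let qX_neq0 n : q ^+ n != 0.
Proof. exact: expf_neq0. Qed.

(** This is 2phi1(q^-n, x; y; q, q) with (q^-n;q)_i rewritten through (q;q)_(n-i). The product on
    the right is x^n (y/x;q)_n without division by x. *)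
Lemma q_Chu_Vandermonde (x y : F) n : (forall m, qpoch y q m != 0) ->
  \sum_(i < n.+1) (-1) ^+ i * q ^+ 'C(n - i, 2) * qpoch x q i
     / (qpoch q q i * qpoch q q (n - i) * qpoch y q i)
  = q ^+ 'C(n, 2) * (\prod_(i < n) (x - y * q ^+ i))
     / (qpoch q q n * qpoch y q n).
Proof.
move=> y_neq0; have y1 m := @qpoch_factor_neq0 _ _ _ m y_neq0.
elim: n => [|n IH]; first by rewrite big_ord1 big_ord0 /= !qpoch0 !mulr1 mul1r.
pose s n i := (-1) ^+ i * q ^+ 'C(n - i, 2) * qpoch x q i
     / (qpoch q q i * qpoch q q (n - i) * qpoch y q i).
(* The certificate is a rational multiple of the summand; its factor 1 - q^i makes [g 0] vanish. The
   constant [c] is the ratio of the right-hand sides at n+1 and n. *)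
pose g i := - s n.+1 i * q ^+ (n.+1 - i) * (1 - q ^+ i) * (1 - y * q ^+ i / q)
   / ((1 - q * q ^+ n) * (1 - y * q ^+ n)).
pose c := q ^+ n * (x - y * q ^+ n) / ((1 - q * q ^+ n) * (1 - y * q ^+ n)).
rewrite (@sum_telescope_rec _ (s n.+1) (s n) g c).
- rewrite /s IH /g /c big_ord_recr /= !qpochS binS bin1 exprD.
  field. by rewrite q_neq0 !qq_neq0 !y_neq0 !onesubq !y1.
- move=> i lein; rewrite /g /c /s; have [d ->] : exists d, n = (i + d)%N.
    by exists (n - i)%N; rewrite subnKC.
  rewrite subSS -addnS !addKn !qpochS binS bin1 !exprD !exprS.
  field.
  by rewrite q_neq0 !qq_neq0 !y_neq0 -!exprD !onesubq !y1.
- rewrite /g subnn expr0 exprS; field.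
  by rewrite q_neq0 !onesubq !y1.
Qed.


(** Both sides satisfy the same inhomogeneous recurrence: [c] is the ratio of consecutive prefactors
    on the right, and - [g 0] is the new term k = n+1, since (b;q)_(n+1) = (1-b) (bq;q)_n. *)
Lemma partial_q_binomial_sum (rho b : F) n :
    rho != 0 -> (forall m, qpoch (b * q) q m != 0) ->
  \sum_(j < n.+1) qpoch rho q j * (-1) ^+ j * q ^+ 'C(n - j, 2)
     / qpoch q q (n - j) * (1 / qpoch (b * q) q j)
  = q ^+ 'C(n, 2) * rho ^+ n / qpoch (b * q) q n
     * \sum_(k < n.+1) qpoch b q k / qpoch q q k * (q / rho) ^+ k.
Proof.
move=> rho_neq0 bq_neq0; have b1 m := @qpoch_factor_neq0 _ _ _ m bq_neq0.
elim: n => [|n IH]; first by rewrite !big_ord1 /= !qpoch0 !mulr1.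
pose s n j := qpoch rho q j * (-1) ^+ j * q ^+ 'C(n - j, 2)
     / qpoch q q (n - j) * (1 / qpoch (b * q) q j).
pose g j := - s n.+1 j * q ^+ (n.+1 - j) * (1 - b * q ^+ j)
   / (1 - b * q * q ^+ n).
pose c := q ^+ n * rho / (1 - b * q * q ^+ n).
rewrite (@sum_telescope_rec _ (s n.+1) (s n) g c).
- rewrite /s IH /g /c [in RHS]big_ord_recr /= /s subn0.
  rewrite [qpoch b q n.+1]qpochSl !qpochS binS bin1 exprD.
  rewrite !qpoch0 !expr0 expr_div_n !exprS.
  by field; rewrite rho_neq0 expf_neq0 // !qq_neq0 !bq_neq0 !onesubq !b1 oner_neq0.
- move=> j lejn; rewrite /g /c /s; have [d ->] : exists d, n = (j + d)%N.
    by exists (n - j)%N; rewrite subnKC.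
  rewrite subSS -addnS !addKn !qpochS binS bin1 !exprD !exprS.
  by field; rewrite !qq_neq0 !bq_neq0 -!exprD !onesubq !b1.
- by rewrite /g subnn expr0 exprS; field; rewrite !b1.
Qed.

(** Expresses that the Bailey matrix and its inverse multiply to the identity. For positive n each
    term is itself a difference of [g], so the telescoping lemma is used with a zero comparison
    sum. *)
Lemma bailey_orthogonality (A : F) n : (forall m, qpoch A q m != 0) ->
  \sum_(i < n.+1) (1 - A * q ^+ (2 * i)) * (-1) ^+ i * q ^+ 'C(i, 2)
     * qpoch A q i / (qpoch q q i * qpoch q q (n - i) * qpoch A q (n + i).+1)
  = (n == 0%N)%:R.
Proof.
move=> A_neq0; have A1 m := @qpoch_factor_neq0 _ _ _ m A_neq0.
case: n => [|n].
  rewrite big_ord1 /= qpochS !qpoch0 !mulr1 !mul1r divff //.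
  by have := A1 0%N; rewrite expr0 mulr1.
pose s i := (1 - A * q ^+ (2 * i)) * (-1) ^+ i * q ^+ 'C(i, 2)
  * qpoch A q i / (qpoch q q i * qpoch q q (n.+1 - i) * qpoch A q (n.+1 + i).+1).
pose g i := - ((-1) ^+ i * q ^+ 'C(i, 2)
  * qpoch A q i / (qpoch q q i * qpoch q q (n.+1 - i) * qpoch A q (n.+1 + i)))
  * (1 - q ^+ i) / (1 - q * q ^+ n).
rewrite (@sum_telescope_rec _ s (fun=> 0) g 0).
- by rewrite /g expr0 subrr mulr0 !mul0r subrr.
- move=> i lein; rewrite /s /g; have [d ->] : exists d, n = (i + d)%N.
    by exists (n - i)%N; rewrite subnKC.
  have -> : ((i + d).+1 - i.+1 = d)%N by lia.
  have -> : ((i + d).+1 - i = d.+1)%N by lia.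
  rewrite mul2n -addnn !addSn !addnS !qpochS binS bin1 !(exprS, exprD).
  by field; rewrite !qq_neq0 !A_neq0 -!exprD !onesubq !A1 -exprS A1.
- rewrite /s /g subnn qpoch0 [qpoch A q (_ + _).+1]qpochS mul2n -addnn -exprS.
  by field; rewrite !qq_neq0 !A_neq0 A1 exprS onesubq.
Qed.

(** * Inversion of the Bailey relation and Bailey's lemma *)

(** After exchanging the sums, the coefficient of [beta m] is the orthogonality sum with A = a
    q^(2m) and length n - m, so only m = n survives. *)
Lemma bailey_inversion (a : F) (beta : nat -> F) :
    (forall n, qpoch a q n != 0) ->
  bailey_pair a q
    (fun n => (1 - a * q ^+ (2 * n)) / (1 - a)
      * \sum_(m < n.+1) qpoch a q (n + m) * (-1) ^+ (n - m)
          * q ^+ 'C(n - m, 2) / qpoch q q (n - m) * beta m)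
    beta.
Proof.
move=> a_neq0 n.
have a1 : 1 - a != 0 by have := @qpoch_factor_neq0 _ _ _ 0 a_neq0; rewrite expr0 mulr1.
pose f j m := (1 - a * q ^+ (2 * j)) / (1 - a)
  * (qpoch a q (j + m) * (-1) ^+ (j - m) * q ^+ 'C(j - m, 2)
       / qpoch q q (j - m) * beta m)
  / (qpoch q q (n - j) * qpoch (a * q) q (n + j)).
transitivity (\sum_(j < n.+1) \sum_(m < j.+1) f j m); last first.
  by apply: eq_bigr => j _; rewrite mulr_sumr mulr_suml.
rewrite sum_triangle_exchange.
have inner (m : 'I_n.+1) : \sum_(i < (n - m).+1) f (m + i)%N m
    = beta m * ((n - m)%N == 0%N)%:R.
  have lemn : (m <= n)%N by rewrite -ltnS.
  have A_neq0 := @qpoch_shift_neq0 _ _ _ (m + m)%N a_neq0.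
  rewrite -(@bailey_orthogonality (a * q ^+ (m + m))) // mulr_sumr.
  apply: eq_bigr => i _; rewrite /f addKn subnDA.
  have -> : qpoch (a * q) q (n + (m + i)) =
    qpoch a q (m + m) * qpoch (a * q ^+ (m + m)) q (n - m + i).+1 / (1 - a).
    rewrite -qpochD; have -> : (m + m + (n - m + i).+1 = (n + (m + i)).+1)%N by lia.
    by rewrite qpochSl mulrAC divff ?mul1r.
  rewrite addnAC qpochD mulnDr exprD mulrA (mul2n m) -addnn.
  by field; rewrite !qq_neq0 !A_neq0 !a_neq0 a1.
rewrite (eq_bigr _ (fun m _ => inner m)) big_ord_recr /= subnn eqxx mulr1.
rewrite big1 ?add0r // => m _.
by rewrite subn_eq0 leqNgt ltn_ord mulr0.
Qed.

Lemma bin2D m n : 'C(m + n, 2) = ('C(m, 2) + 'C(n, 2) + m * n)%N.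
Proof.
elim: n => [|n IH]; first by rewrite addn0 muln0 !addn0.
by rewrite addnS !binS !bin1 IH mulnS; lia.
Qed.

(* The limit rho1 -> 0, rho2 = rho of Bailey's lemma. *)
Lemma bailey_lemma_rho (a rho : F) (alpha beta : nat -> F) :
    rho != 0 -> (forall n, qpoch (a * q) q n != 0) ->
    (forall n, qpoch (a * q / rho) q n != 0) ->
    bailey_pair a q alpha beta ->
  bailey_pair a q
    (fun n => qpoch rho q n * (-1) ^+ n
      / (rho ^+ n * q ^+ 'C(n, 2) * qpoch (a * q / rho) q n) * alpha n)
    (fun n => (\sum_(j < n.+1) qpoch rho q j * (-1) ^+ j * q ^+ 'C(n - j, 2)
         / qpoch q q (n - j) * beta j)
      / (rho ^+ n * q ^+ 'C(n, 2) * qpoch (a * q / rho) q n)).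
Proof.
move=> rho_neq0 aq_neq0 aqr_neq0 alphabeta n.
pose f j m := qpoch rho q j * (-1) ^+ j * q ^+ 'C(n - j, 2)
  / qpoch q q (n - j) * (alpha m / (qpoch q q (j - m) * qpoch (a * q) q (j + m))).
have -> : \sum_(j < n.+1) qpoch rho q j * (-1) ^+ j * q ^+ 'C(n - j, 2)
         / qpoch q q (n - j) * beta j = \sum_(j < n.+1) \sum_(m < j.+1) f j m.
  by apply: eq_bigr => j _; rewrite alphabeta mulr_sumr.
rewrite sum_triangle_exchange mulr_suml; apply: eq_bigr => m _.
have y_neq0 := @qpoch_shift_neq0 _ _ _ (m + m)%N aq_neq0.
rewrite /f; move: (nat_of_ord m) (ltn_ord m) y_neq0 => {f}m ltmn y_neq0.
have [N ->] : exists N, n = (m + N)%N.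
  by exists (n - m)%N; rewrite subnKC // -ltnS.
rewrite addKn.
(* With n = m + N, the coefficient of [alpha m] is a Chu-Vandermonde sum of length N in x = rho q^m,
   y = a q^(2m+1). *)
have := @q_Chu_Vandermonde (rho * q ^+ m) (a * q * q ^+ (m + m)) N y_neq0.
have -> : \prod_(i < N) (rho * q ^+ m - a * q * q ^+ (m + m) * q ^+ i)
    = rho ^+ N * q ^+ (m * N) * qpoch (a * q / rho * q ^+ m) q N.
  have fact i : rho * q ^+ m - a * q * q ^+ (m + m) * q ^+ i
      = rho * q ^+ m * (1 - a * q / rho * q ^+ m * q ^+ i).
    by rewrite exprD; field.
  under eq_bigr do rewrite fact.
  by rewrite big_split /= prodr_const card_ord exprMn exprM.
move=> CV.
transitivity (qpoch rho q m * (-1) ^+ m * alpha m / qpoch (a * q) q (m + m)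
    * (q ^+ 'C(N, 2) *
         (rho ^+ N * q ^+ (m * N) * qpoch (a * q / rho * q ^+ m) q N) /
         (qpoch q q N * qpoch (a * q * q ^+ (m + m)) q N))
    / (rho ^+ (m + N) * q ^+ 'C(m + N, 2) * qpoch (a * q / rho) q (m + N))).
  rewrite -CV mulr_sumr; congr (_ / _); apply: eq_bigr => i _.
  rewrite subnDl addKn addnAC [qpoch (a * q) q _]qpochD [qpoch rho q _]qpochD exprD.
  by field; rewrite !qq_neq0 !aq_neq0 !y_neq0.
rewrite bin2D (addnAC m N m) [qpoch (a * q) q (m + m + N)]qpochD.
rewrite [qpoch (a * q / rho) q (m + N)]qpochD (exprD rho).
rewrite (exprD q (_ + _)%N) (exprD q 'C(m, 2)).
by field; rewrite !qq_neq0 !aq_neq0 !y_neq0 !expf_neq0 // !aqr_neq0 qpoch_shift_neq0.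
Qed.

(** * The closed form of A_n(q,q,b) *)

Lemma Aqq_exponent n : (n * (3 * n + 1))./2 = (n ^ 2 + 'C(n.+1, 2))%N.
Proof.
rewrite bin2 /=; have -> : (n * (3 * n + 1) = (n ^ 2).*2 + n.+1 * n)%N by lia.
by rewrite halfD odd_double doubleK add0n.
Qed.

(** The right side is the inversion formula at a = q. With the sign (-1)^n pulled out, its sum obeys
    a first order recurrence whose inhomogeneous part - [g 0] is the new term j = n+1 of the inner
    sum of A_n. *)
Lemma Aqq_sum (b : F) n : b != 0 ->
    (forall m, qpoch (b * q) q m != 0) -> (forall m, qpoch (q / b) q m != 0) ->
  Aqq q b n = (1 - q * q ^+ (2 * n)) / (1 - q)
      * \sum_(m < n.+1) qpoch q q (n + m) * (-1) ^+ (n - m)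
          * q ^+ 'C(n - m, 2) / qpoch q q (n - m) * (1 / qpoch (b * q) q m).
Proof.
move=> b_neq0 bq_neq0 qb_neq0.
have b1 m := @qpoch_factor_neq0 _ _ _ m bq_neq0.
have qb1 m := @qpoch_factor_neq0 _ _ _ m qb_neq0.
have q1 : 1 - q != 0 by have := onesubq 0; rewrite expr0 mulr1.
pose s n m := qpoch q q (n + m) * (-1) ^+ m
  * q ^+ 'C(n - m, 2) / qpoch q q (n - m) * (1 / qpoch (b * q) q m).
transitivity ((1 - q * q ^+ (2 * n)) / (1 - q)
    * ((-1) ^+ n * \sum_(m < n.+1) s n m)); last first.
  congr (_ * _); rewrite mulr_sumr; apply: eq_bigr => m _; rewrite /s.
  have lemn : (m <= n)%N by rewrite -ltnS.
  have <- : (-1) ^+ n * (-1) ^+ m = (-1) ^+ (n - m) :> F.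
    by rewrite -{1}(subnK lemn) exprD -mulrA -expr2 sqrr_sign mulr1.
  by rewrite !mulrA [(-1) ^+ n * _]mulrC.
pose u := fun j => (qpoch q q j.-1 * (1 - q ^+ (2 * j)) * qpoch b q j
              * q ^- (j ^ 2) * b ^- j) / (qpoch q q j * qpoch (q / b) q j).
have -> : \sum_(m < n.+1) s n m =
  q ^+ (n ^ 2) * q ^+ 'C(n.+1, 2) * b ^+ n * qpoch (q / b) q n
    / qpoch (b * q) q n * (1 + \sum_(1 <= j < n.+1) u j).
  elim: n => [|n IH].
    by rewrite big_ord1 big_geq // /s /= !qpoch0 !mulr1 addr0 !divr1 mulr1.
  pose g j := - (qpoch q q (n + j) * (-1) ^+ j * q ^+ 'C(n.+1 - j, 2)
     / qpoch q q (n.+1 - j) * (1 / qpoch (b * q) q j)) * q ^+ (n.+1 - j)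
    * (1 - b * q ^+ j) * (1 - q ^+ n.+1 * q ^+ n.+1) / (1 - b * q * q ^+ n).
  (* The ratio of consecutive prefactors: q^(2n+1) from n^2, q^(n+1) from the binomial, and b (1 -
     q^(n+1)/b) written as b - q^(n+1). *)
  pose c := q ^+ n * q ^+ n * q ^+ n * q * q * (b - q ^+ n.+1)
    / (1 - b * q * q ^+ n).
  rewrite (@sum_telescope_rec _ (s n.+1) (s n) g c).
  - rewrite IH (@big_nat_recr _ _ _ n.+1 1) //= /u /=.
    set S := \sum_(1 <= j < n.+1) _; rewrite /c /g subn0 addn0.
    rewrite [qpoch b q n.+1]qpochSl !qpochS !qpoch0.
    rewrite [in 'C(n.+2, 2)]binS bin1 -!mulnn mulSn mulnS mul2n -addnn.
    rewrite !exprD !exprS expr0.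
    have bq1 : b - q * q ^+ n != 0.
      rewrite (_ : b - _ = b * (1 - q / b * q ^+ n)); last by field.
      by rewrite mulf_neq0.
    by field; rewrite b_neq0 expf_neq0 // !qX_neq0 q_neq0 bq1 !onesubq !b1
      qb_neq0 qq_neq0 bq_neq0 oner_neq0.
  - move=> j lejn; rewrite /g /c /s; have [d ->] : exists d, n = (j + d)%N.
      by exists (n - j)%N; rewrite subnKC.
    have -> : ((j + d).+1 - j.+1 = d)%N by lia.
    have -> : ((j + d).+1 - j = d.+1)%N by lia.
    rewrite addKn !addSn !addnS !qpochS binS bin1 !(exprS, exprD).
    by field; rewrite !qq_neq0 !bq_neq0 -!exprD !onesubq !b1.
  - rewrite /g /s subnn expr0 addSn [qpoch q q (_ + _).+1]qpochS exprD exprS.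
    by field; rewrite !qq_neq0 !b1 !bq_neq0.
rewrite /Aqq Aqq_exponent !exprD expr1.
by field; rewrite q1 bq_neq0.
Qed.

(** * Specialising rho *)

Lemma eq_bailey_pair (a : F) (alpha alpha' beta beta' : nat -> F) :
    alpha =1 alpha' -> beta =1 beta' ->
  bailey_pair a q alpha beta -> bailey_pair a q alpha' beta'.
Proof.
move=> eqa eqb ab n; rewrite -eqb ab.
by apply: eq_bigr => j _; rewrite eqa.
Qed.

Lemma Aqq_bailey_pair_rho (rho b : F) : rho != 0 -> b != 0 ->
    (forall n, qpoch (q * q / rho) q n != 0) ->
    (forall n, qpoch (b * q) q n != 0) -> (forall n, qpoch (q / b) q n != 0) ->
  bailey_pair q q
    (fun n => qpoch rho q n * (-1) ^+ n
      / (rho ^+ n * q ^+ 'C(n, 2) * qpoch (q * q / rho) q n) * Aqq q b n)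
    (fun n => 1 / (qpoch (q * q / rho) q n * qpoch (b * q) q n)
       * \sum_(k < n.+1) qpoch b q k / qpoch q q k * (q / rho) ^+ k).
Proof.
move=> rho_neq0 b_neq0 qqr_neq0 bq_neq0 qb_neq0.
have aq_neq0 n : qpoch (q * q) q n != 0.
  by have := @qpoch_shift_neq0 _ _ _ 1 qq_neq0 n; rewrite expr1.
have := @bailey_inversion q (fun n => 1 / qpoch (b * q) q n) qq_neq0.
move/(bailey_lemma_rho _ _ _ _ rho_neq0 aq_neq0 qqr_neq0); apply: eq_bailey_pair => n.
  by rewrite Aqq_sum.
rewrite partial_q_binomial_sum //.
by field; rewrite !expf_neq0 // qqr_neq0 bq_neq0.
Qed.

(** It divides 1 - q^(2n+1) = (1 - h q^n)(1 + h q^n), which is nonzero. *)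
Lemma one_add_sqrt_mulX_neq0 (h : F) n : h ^+ 2 = q -> 1 + h * q ^+ n != 0.
Proof.
move=> hq; have := onesubq (n + n).
rewrite -hq exprD (_ : _ - _ = (1 - h * h ^+ 2 ^+ n) * (1 + h * h ^+ 2 ^+ n)).
  by rewrite mulf_eq0 negb_or => /andP[].
by ring.
Qed.

(** At rho = -q one has q^2/rho = rho, so the two Pochhammer symbols in [alpha] cancel and only a
    power of q remains. *)
Lemma Aqq_bailey_pair_integral (b : F) : b != 0 ->
    (forall n, qpoch (b * q) q n != 0) -> (forall n, qpoch (q / b) q n != 0) ->
  bailey_pair q q
    (fun n => q ^- (n * (n + 1))./2 * Aqq q b n)
    (fun n => 1 / (qpoch (- q) q n * qpoch (b * q) q n)
       * \sum_(k < n.+1) qpoch b q k / qpoch q q k * (-1) ^+ k).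
Proof.
move=> b_neq0 bq_neq0 qb_neq0.
have eq1 : q * q / - q = - q by field; rewrite oppr_eq0.
have eq2 : q / - q = -1 by field; rewrite oppr_eq0.
have mq_neq0 : forall n, qpoch (- q) q n != 0.
  (* The factor 1 + q^(n+1) divides 1 - q^(2n+2). *)
  apply: qpoch_neq0 => n; have := onesubq (n + n.+1).
  rewrite exprD exprS (_ : _ - _ = (1 - q * q ^+ n) * (1 - - q * q ^+ n)).
    by rewrite mulf_eq0 negb_or => /andP[].
  by ring.
have := @Aqq_bailey_pair_rho (- q) b.
rewrite oppr_eq0 eq1 eq2 => /(_ q_neq0 b_neq0 mq_neq0 bq_neq0 qb_neq0).
apply: eq_bailey_pair => n //; congr (_ * _).
have -> : ((n * (n + 1))./2 = 'C(n, 2) + n)%N.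
  by rewrite addn1 mulnC -(bin2 n.+1) binS bin1.
rewrite exprD (exprNn q).
by field; rewrite !qX_neq0 mq_neq0 signr_eq0.
Qed.

(** At rho = -h one has q^2/rho = rho q, so the Pochhammer quotient leaves (1 + h)/(1 + h q^n),
    while h^n q^C(n,2) = h^(n^2). *)
Lemma Aqq_bailey_pair_half (h b : F) : h ^+ 2 = q -> b != 0 ->
    (forall n, qpoch (b * q) q n != 0) -> (forall n, qpoch (q / b) q n != 0) ->
  bailey_pair q q
    (fun n => (1 + h) / (1 + h ^+ (2 * n + 1)) * h ^- (n ^ 2) * Aqq q b n)
    (fun n => 1 / (qpoch (- h ^+ 3) q n * qpoch (b * q) q n)
       * \sum_(k < n.+1) qpoch b q k / qpoch q q k * (- h) ^+ k).
Proof.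
move=> hq b_neq0 bq_neq0 qb_neq0.
have h_neq0 : h != 0 by move: q_neq0; rewrite -hq expf_eq0.
have eq1 : q * q / - h = - h ^+ 3 by rewrite -hq; field; rewrite oppr_eq0.
have eq2 : q / - h = - h by rewrite -hq; field; rewrite oppr_eq0.
have mh_neq0 : forall n, qpoch (- h ^+ 3) q n != 0.
  apply: qpoch_neq0 => n.
  rewrite exprS hq mulNr opprK -mulrA -exprS; exact: one_add_sqrt_mulX_neq0.
have := @Aqq_bailey_pair_rho (- h) b.
rewrite oppr_eq0 eq1 eq2 => /(_ h_neq0 b_neq0 mh_neq0 bq_neq0 qb_neq0).
apply: eq_bailey_pair => n //; congr (_ * _).
(* Both sides are (-h;q)_(n+1), split off at its last and at its first factor. *)
have shift : qpoch (- h) q n * (1 + h * q ^+ n) = (1 + h) * qpoch (- h ^+ 3) q n.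
  have := @qpochSl _ (- h) q n; rewrite qpochS !mulNr !opprK => ->.
  by rewrite -hq -exprS.
have -> : (n ^ 2 = 2 * 'C(n, 2) + n)%N.
  by elim: (n) => [|k IH] //; rewrite binS bin1 mulnDr -!mulnn; lia.
have hn := @one_add_sqrt_mulX_neq0 h n hq.
rewrite !(exprD, exprM) expr1 hq (exprNn h).
rewrite (canRL (mulfK hn) shift) (mulrC (q ^+ n) h).
by field; rewrite !expf_neq0 ?oppr_eq0 ?oner_neq0 // mh_neq0 hn.
Qed.

End BaileyPairs.

Theorem theorem2p3 (R : realType) (q : R) (b : R[i])
    (q_gt0 : 0 < q) (q_lt1 : q < 1) (b_neq0 : b != 0)
    (bq_neq0 : forall n : nat, qpoch (b * q%:C) q%:C n != 0)
    (qb_neq0 : forall n : nat, qpoch (q%:C / b) q%:C n != 0) :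
  let Q : R[i] := q%:C in
  let Qh : R[i] := (Num.sqrt q)%:C in
  bailey_pair Q Q
    (fun n : nat => Q ^- (n * (n + 1))./2 * Aqq Q b n)
    (fun n : nat =>
       1 / (qpoch (- Q) Q n * qpoch (b * Q) Q n)
       * \sum_(k < n.+1) qpoch b Q k / qpoch Q Q k * (-1) ^+ k)
  /\
  bailey_pair Q Q
    (fun n : nat =>
       (1 + Qh) / (1 + Qh ^+ (2 * n + 1)) * Qh ^- (n ^ 2) * Aqq Q b n)
    (fun n : nat =>
       1 / (qpoch (- Qh ^+ 3) Q n * qpoch (b * Q) Q n)
       * \sum_(k < n.+1) qpoch b Q k / qpoch Q Q k * (- Qh) ^+ k).
Proof.
move=> Q Qh.
have Q_neq0 : Q != 0 by rewrite fmorph_eq0 gt_eqF.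
have QQ_neq0 : forall n, qpoch Q Q n != 0.
  (* Each factor is the image of the real number 1 - q^(n+1), nonzero because q^(n+1) < 1. *)
  apply: qpoch_neq0 => n; rewrite -exprS /Q -rmorphXn -(rmorph1 (real_complex R)).
  by rewrite -rmorphB fmorph_eq0 subr_eq0 gt_eqF // exprn_ilt1 // ltW.
have sqQ : Qh ^+ 2 = Q by rewrite -rmorphXn sqr_sqrtr // ltW.
split; first exact: Aqq_bailey_pair_integral.
exact: Aqq_bailey_pair_half.
Qed.
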